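(* Let $Q\in\mathbb{C}^{N\times N}$ be a matrix all of whose eigenvalues have positive real part, and let $x>0$. Then $$\gamma(Q+I,x)=Q\,\gamma(Q,x)-e^{-x}x^{Q}$$ and $$\Gamma(Q+I,x)=Q\,\Gamma(Q,x)+e^{-x}x^{Q}.$$
   Context: $I$ is the identity matrix in $\mathbb{C}^{N\times N}$, and $t^{M}=\exp(M\ln t)$ for $t>0$ and $M\in\mathbb{C}^{N\times N}$. For a matrix $Q\in\mathbb{C}^{N\times N}$ all of whose eigenvalues have positive real part and $x>0$, the incomplete gamma matrix functions are $$\gamma(Q,x)=\int_0^x u^{Q-I}e^{-u}\,du,\qquad \Gamma(Q,x)=\int_x^\infty u^{Q-I}e^{-u}\,du .$$ *)

(* Defs.v *)
From HB Require Import structures.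
From mathcomp Require Import all_boot all_order all_algebra.
From mathcomp Require Import complex.
From mathcomp Require Import all_classical all_reals all_analysis.

Set Implicit Arguments.
Unset Strict Implicit.
Unset Printing Implicit Defensive.

Import Order.TTheory GRing.Theory Num.Theory.
Import numFieldNormedType.Exports.

Local Open Scope classical_set_scope.
Local Open Scope ring_scope.
Local Open Scope complex_scope.

(* MathComp-Analysis puts the topology of C on the alias R[i]^o of R[i]; the
   limit is taken in the normed space of N x N matrices over it. *)
Definition mxexp (R : realType) (N : nat) (M : 'M[R[i]]_N) : 'M[R[i]]_N :=
  limn (series (fun k : nat => k`!%:R^-1 *: M ^+ k : 'M[R[i]^o]_N)).

(* Only meaningful for 0 < t. *)
Definition mxpow (R : realType) (N : nat) (t : R) (M : 'M[R[i]]_N) :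
    'M[R[i]]_N :=
  mxexp ((ln t)%:C *: M).

(* Entrywise Lebesgue integral of the real and imaginary parts. *)
Definition mxintegral (R : realType) (N : nat) (D : set R)
    (F : R -> 'M[R[i]]_N) : 'M[R[i]]_N :=
  \matrix_(i < N, j < N)
    ((\int[lebesgue_measure]_(u in D) complex.Re (F u i j))%R +i*
     (\int[lebesgue_measure]_(u in D) complex.Im (F u i j))%R).

Definition gamma_integrand (R : realType) (N : nat) (Q : 'M[R[i]]_N) (u : R) :
    'M[R[i]]_N :=
  (expR (- u))%:C *: mxpow u (Q - 1%:M).

(* The point 0, at which the integrand is undefined, is left out. *)
Definition lower_gamma (R : realType) (N : nat) (Q : 'M[R[i]]_N) (x : R) :
    'M[R[i]]_N :=
  mxintegral `]0, x] (gamma_integrand Q).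

Definition upper_gamma (R : realType) (N : nat) (Q : 'M[R[i]]_N) (x : R) :
    'M[R[i]]_N :=
  mxintegral `[x, +oo[ (gamma_integrand Q).

(* Main.v *)
(* Put E_A(s) = exp(sA), so that u^Q = E_Q(ln u), and W(u) = e^{-u} u^Q. Then
   W'(u) = Q e^{-u} u^{Q-I} - e^{-u} u^Q, and both identities are the
   fundamental theorem of calculus for W on (0, x] and on [x, oo).

   The convergence of the integrals and the vanishing of W at 0 and oo rest on
   the spectral bound E_Q(s) = O(e^{ds} + e^{Ks}), valid when 0 < d < Re l < K
   for all the eigenvalues l of Q. By Cayley-Hamilton prod_k (Q - l_k) = 0; the
   matrices Y_k = (Q - l_1) ... (Q - l_k) E_Q satisfy
   Y_k' = l_{k+1} Y_k + Y_{k+1}, so the bound descends from Y_n = 0 to Y_0 = E_Q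
   by a scalar Gronwall argument. The same descent gives uniqueness for
   Y' = Q Y, hence exp(sQ) = e^s exp(s(Q - I)). *)
Require Import Defs.
From HB Require Import structures.
From mathcomp Require Import all_boot all_order all_algebra.
From mathcomp Require Import complex.
From mathcomp Require Import all_classical all_reals all_analysis.
From mathcomp Require Import measurable_realfun ring lra.

Set Implicit Arguments.
Unset Strict Implicit.
Unset Printing Implicit Defensive.

Import Order.TTheory GRing.Theory Num.Theory.
Import numFieldNormedType.Exports.

Local Open Scope classical_set_scope.
Local Open Scope ring_scope.
Local Open Scope complex_scope.

(** * Real and imaginary parts of complex numbers *)

Section ComplexAux.
Variable R : rcfType.
Implicit Types z w : R[i].

Lemma reD z w : complex.Re (z + w) = complex.Re z + complex.Re w.
Proof. by case: z w => [a b] [c d]. Qed.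

Lemma reB z w : complex.Re (z - w) = complex.Re z - complex.Re w.
Proof. by case: z w => [a b] [c d]. Qed.

Lemma re_sum (I : Type) (r : seq I) (P : pred I) (F : I -> R[i]) :
  complex.Re (\sum_(k <- r | P k) F k) = \sum_(k <- r | P k) complex.Re (F k).
Proof. by elim/big_rec2: _ => //= k _ y _ <-; rewrite reD. Qed.

Lemma reMr z (t : R) : complex.Re (z * t%:C) = complex.Re z * t.
Proof. by case: z => [a b] /=; rewrite mulr0 subr0. Qed.

(** Multiplying by -i turns imaginary parts into real parts, so statements about all the functions
    Re(c z) cover both components. *)
Lemma im_re z : complex.Im z = complex.Re ((0 -i* 1) * z).
Proof. by case: z => a b /=; rewrite mul0r sub0r mulN1r opprK. Qed.

(** The factor [1] is kept so that both terms on the right have the shape Re(c w), with c = 1 and c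
    = -i. *)
Lemma re_mulE z w : complex.Re (z * w) =
  complex.Re z * complex.Re (1 * w)
  - complex.Im z * complex.Re ((0 -i* 1) * w).
Proof. by rewrite -im_re mul1r; case: z w => [a b] [c d]. Qed.

Lemma eq_complex_Re z w :
  (forall c, complex.Re (c * z) = complex.Re (c * w)) -> z = w.
Proof.
move=> h; apply/eqP; rewrite eq_complex !im_re h eqxx andbT.
by have := h 1; rewrite !mul1r => ->.
Qed.

Lemma norm_Re_le z : `|complex.Re z| <= complex.Re `|z|.
Proof. by have := normc_ge_Re z; rewrite lecE /= => /andP[]. Qed.

Lemma norm_le_ReIm z : `|z| <= (`|complex.Re z| + `|complex.Im z|)%:C.
Proof.
case: z => a b; rewrite normc_def lecR /= -ler_sqr ?nnegrE ?addr_ge0 ?sqrtr_ge0//.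
rewrite sqr_sqrtr ?addr_ge0 ?sqr_ge0//.
by rewrite sqrrD !real_normK ?num_real// addrAC lerDl mulrn_wge0 ?mulr_ge0.
Qed.

End ComplexAux.

(** * Componentwise and entrywise convergence *)

Lemma cvg_complex (R : realType) (u : nat -> R[i]^o) (l : R[i]^o) :
  complex.Re (u n) @[n --> \oo] --> complex.Re l ->
  complex.Im (u n) @[n --> \oo] --> complex.Im l -> u @ \oo --> l.
Proof.
(* A positive [e] in the order of [R[i]] is a positive real number; half of it is allotted to each
   component. *)
move=> hR hI; apply/cvgrPdist_lt => e; rewrite ltcE /= => /andP[/eqP eI e0].
move/cvgrPdist_lt : hR => /(_ (complex.Re e / 2)); rewrite divr_gt0// => /(_ isT).
move/cvgrPdist_lt : hI => /(_ (complex.Re e / 2)); rewrite divr_gt0// => /(_ isT).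
move=> hI hR; near=> n.
apply: le_lt_trans (norm_le_ReIm _) _.
rewrite ltcE /= eI eqxx /=.
have -> (a b : R[i]) : complex.Re (a - b) = complex.Re a - complex.Re b.
  by case: a b => [? ?] [? ?].
have -> (a b : R[i]) : complex.Im (a - b) = complex.Im a - complex.Im b.
  by case: a b => [? ?] [? ?].
by rewrite [ltRHS]splitr ltrD//; near: n.
Unshelve. all: by end_near. Qed.

(** A neighbourhood of a matrix contains a product of neighbourhoods of its entries, and these are
    finitely many. *)
Lemma cvg_mxP (T : topologicalType) (m n : nat) (u : nat -> 'M[T]_(m, n))
    (l : 'M[T]_(m, n)) :
  (forall i j, u k i j @[k --> \oo] --> l i j) -> u @ \oo --> l.
Proof.
move=> h A [P Pl sPA]; rewrite /nbhs /=.
suff : \forall k \near \oo, forall i j, P i j (u k i j).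
  by apply: filterS => k; exact: sPA.
by apply: filter_forall => i; apply: filter_forall => j; apply: h; exact: Pl.
Qed.

(** * The matrix exponential as a family of real power series *)

Section MatrixExponential.
Variable R : realType.

(* Matrices are differentiated entrywise, and a complex-valued function through
   the real functions Re (c f), which include its real and imaginary parts. *)
Definition cderive (f : R -> R[i]) (s : R) (d : R[i]) :=
  forall c, is_derive s 1 (fun t => complex.Re (c * f t)) (complex.Re (c * d)).

(** Comparison with [M] times the exponential series at |K x|. *)
Lemma is_cvg_pseries_geom_fact (a : R^nat) (M K x : R) :
  (forall k, `|a k| <= M * K ^+ k / k`!%:R) -> cvgn (pseries a x).
Proof.
move=> h; apply: normed_cvg.
have M0 : 0 <= M by have := h 0%N; rewrite expr0 mulr1 fact0 divr1; apply: le_trans.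
apply: (@series_le_cvg _ _ (fun k => M * exp_coeff (`|K * x|) k)).
- by move=> k /=.
- by move=> k /=; rewrite mulr_ge0// exp_coeff_ge0.
- move=> k; rewrite /exp_coeff /= normrM normrX mulrA.
  apply: le_trans (ler_wpM2r (exprn_ge0 k (normr_ge0 x)) (h k)) _.
  rewrite mulrAC -[X in X / _ <= _]mulrA -exprMn ler_wpM2r ?invr_ge0//.
  by rewrite ler_wpM2l// (le_trans (ler_norm _))// normrX !normrM normr_id.
- have -> : series (fun k => M * exp_coeff `|K * x| k) =
            (fun k => M * series (exp_coeff `|K * x|) k).
    by apply/funext => k; rewrite /series /= mulr_sumr.
  by apply: is_cvgMr; exact: is_cvg_series_exp_coeff.
Qed.

Lemma cvg_sumr (I : Type) (r : seq I) (u : I -> R^nat) (l : I -> R) :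
  (forall i, u i @ \oo --> l i) ->
  (fun k => \sum_(i <- r) u i k) @ \oo --> \sum_(i <- r) l i.
Proof.
move=> h; elim: r => [|i r IH].
  by under eq_cvg do rewrite big_nil; rewrite big_nil; exact: cvg_cst.
under eq_cvg do rewrite big_cons.
by rewrite big_cons; apply: cvgD.
Qed.

Variable n : nat.
Implicit Types A : 'M[R[i]]_n.+1.

(** The sum [S] of the moduli of all entries dominates each row sum, so by induction the entries of
    A^k are at most S^k in modulus. *)
Lemma mxpow_entry_bound A : exists2 K : R, 0 <= K &
  forall (c : R[i]) k i j, `|complex.Re (c * (A ^+ k) i j)| <= complex.Re `|c| * K ^+ k.
Proof.
pose S : R[i] := \sum_i \sum_j `|A i j|.
have S0 : 0 <= S by do 2 (apply: sumr_ge0 => ? _).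
have SE : S = (complex.Re S)%:C by rewrite RRe_real// ger0_real.
have h k i j : `|(A ^+ k) i j| <= S ^+ k.
  elim: k i j => [|k IH] i j.
    by rewrite !expr0 mxE; case: (i == j); rewrite ?normr1 ?normr0 ?ler01.
  rewrite exprS mxE (le_trans (ler_norm_sum _ _ _))// exprS.
  have : \sum_j `|A i j| * S ^+ k <= S * S ^+ k.
    rewrite -mulr_suml; apply: ler_wpM2r; first exact: exprn_ge0.
    rewrite [leRHS](bigD1 i)//= lerDl.
    by do 2 (apply: sumr_ge0 => ? _).
  apply: le_trans; apply: ler_sum => l _.
  by rewrite normrM ler_wpM2l.
exists (complex.Re S); first by move: S0; rewrite SE lecR.
move=> c k i j; apply: le_trans (norm_Re_le _) _.
rewrite normrM.
have : `|c| * `|(A ^+ k) i j| <= `|c| * (complex.Re S ^+ k)%:C.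
  by rewrite ler_wpM2l// rmorphXn /= -SE.
by rewrite lecE [X in _ <= X]reMr => /andP[].
Qed.

(** Taylor coefficients at 0 of the real function s -> Re(c exp(sA)_ij). *)
Definition exp_coef A (c : R[i]) i j (k : nat) : R :=
  complex.Re (c * (A ^+ k) i j) / k`!%:R.

Lemma is_cvg_exp_coef A c i j x : cvgn (pseries (exp_coef A c i j) x).
Proof.
have [K K0 h] := mxpow_entry_bound A.
apply: (@is_cvg_pseries_geom_fact _ (complex.Re `|c|) K) => k.
by rewrite /exp_coef normrM normfV [`|_%:R|]ger0_norm// ler_wpM2r.
Qed.

Lemma mxexp_scaleE A (s : R) c i j :
  complex.Re (c * mxexp (s%:C *: A) i j) = limn (pseries (exp_coef A c i j) s).
Proof.
pose P d i j := pseries (exp_coef A d i j) s.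
(* The limit is assembled from the series for c = 1 and c = -i; a general [c] is then reached by
   real linear combination. *)
pose L : 'M[R[i]]_n.+1 := \matrix_(i, j)
  (limn (P 1 i j) +i* limn (P (0 -i* 1) i j)).
pose S := series (fun k : nat => k`!%:R^-1 *: (s%:C *: A) ^+ k).
have SE d i' j' k : complex.Re (d * S k i' j') = P d i' j' k.
  rewrite /S /P /pseries /series /= summxE mulr_sumr re_sum.
  apply: eq_bigr => m _; rewrite exprZn scalerA mxE /exp_coef.
  have -> : (m`!%:R^-1 * s%:C ^+ m : R[i]) = (m`!%:R^-1 * s ^+ m)%:C.
    by rewrite rmorphM rmorphXn fmorphV rmorph_nat.
  by rewrite mulrCA mulrC reMr mulrA.
have cP d i' j' : P d i' j' @ \oo --> limn (P d i' j').
  exact: is_cvg_exp_coef.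
have -> : mxexp (s%:C *: A) = L.
  apply: (@cvg_lim 'M[R[i]^o]_n.+1); first exact: norm_hausdorff.
  apply: cvg_mxP => i' j'; apply: cvg_complex; rewrite mxE /=.
    under eq_cvg do rewrite -[S _ _ _]mul1r SE.
    exact: cP.
  under eq_cvg do rewrite im_re SE.
  exact: cP.
rewrite re_mulE mxE mul1r -im_re /=; apply/esym.
have -> : pseries (exp_coef A c i j) s =
    (fun k => complex.Re c * P 1 i j k - complex.Im c * P (0 -i* 1) i j k).
  by apply/funext => k; rewrite -[LHS]SE re_mulE !SE.
by apply: cvg_lim => //; apply: cvgB; apply: cvgMr; exact: cP.
Qed.

(** Since (k+1)/(k+1)! = 1/k! and A^(k+1) = A A^k, formal differentiation multiplies by [A] on the
    left. The result is a finite sum of series of the same kind, so every formal derivative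
    converges as well. *)
Lemma pseries_diffs_exp_coef A c i j : pseries_diffs (exp_coef A c i j) =
  (fun k => \sum_l exp_coef A (c * A i l) l j k).
Proof.
apply/funext => k; rewrite /pseries_diffs /exp_coef factS natrM invfM mulrCA.
rewrite mulVKf ?pnatr_eq0// -mulr_suml -re_sum exprS mxE mulr_sumr.
by under eq_bigr do rewrite mulrA.
Qed.

Lemma pseries_sum (I : Type) (r : seq I) (f : I -> R^nat) x :
  pseries (fun k => \sum_(l <- r) f l k) x =
  (fun k => \sum_(l <- r) pseries (f l) x k).
Proof.
apply/funext => k; rewrite /pseries /series /= exchange_big /=.
by apply: eq_bigr => m _; rewrite mulr_suml.
Qed.

Definition mderive (Y : R -> 'M[R[i]]_n.+1) (s : R) (D : 'M[R[i]]_n.+1) :=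
  forall i j, cderive (fun t => Y t i j) s (D i j).

Lemma mxexp_derive A (s : R) :
  mderive (fun t => mxexp (t%:C *: A)) s (A *m mxexp (s%:C *: A)).
Proof.
move=> i j c.
have cd x : pseries (pseries_diffs (exp_coef A c i j)) x @ \oo -->
    \sum_l limn (pseries (exp_coef A (c * A i l) l j) x).
  rewrite pseries_diffs_exp_coef pseries_sum.
  by apply: cvg_sumr => l; exact: is_cvg_exp_coef.
have -> : complex.Re (c * (A *m mxexp (s%:C *: A)) i j) =
    limn (pseries (pseries_diffs (exp_coef A c i j)) s).
  rewrite (cvg_lim _ (cd s))// mxE mulr_sumr re_sum.
  by apply: eq_bigr => l _; rewrite mulrA mxexp_scaleE.
have -> : (fun t => complex.Re (c * mxexp (t%:C *: A) i j)) =
    (fun t => limn (pseries (exp_coef A c i j) t)).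
  by apply/funext => t; rewrite mxexp_scaleE.
(* Termwise differentiation at [s] asks for convergence of the series and its first two formal
   derivatives at a point of larger modulus. *)
apply: (@pseries_snd_diffs _ _ (`|s| + 1)).
- exact: is_cvg_exp_coef.
- by apply: cvgP; exact: cd.
- rewrite pseries_diffs_exp_coef.
  have -> : pseries_diffs (fun k => \sum_l exp_coef A (c * A i l) l j k) =
      (fun k => \sum_l pseries_diffs (exp_coef A (c * A i l) l j) k).
    by apply/funext => k; rewrite /pseries_diffs mulr_sumr.
  rewrite pseries_sum; apply: cvgP; apply: cvg_sumr => l.
  rewrite pseries_diffs_exp_coef pseries_sum.
  by apply: cvgP; apply: cvg_sumr => m; exact: is_cvg_exp_coef.
- by rewrite [ltRHS]ger0_norm ?addr_ge0// ltrDl.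
Qed.

Lemma mxexp0 A : mxexp (0%:C *: A) = 1%:M.
Proof.
apply/matrixP => i j; apply: eq_complex_Re => c; rewrite mxexp_scaleE.
(* The empty partial sum is skipped; all the later ones equal the term of index 0. *)
apply: cvg_lim => //; rewrite -(cvg_shiftn 1) /=.
have -> : (fun k => pseries (exp_coef A c i j) 0 (k + 1)%N) =
    cst (complex.Re (c * (1%:M : 'M[R[i]]_n.+1) i j)).
  apply/funext => k; rewrite /pseries /series /= addn1 big_nat_recl//=.
  rewrite big1_seq => [|m _]; last by rewrite expr0n mulr0.
  by rewrite /exp_coef !expr0 addr0 mulr1 fact0 divr1.
exact: cvg_cst.
Qed.

End MatrixExponential.

(** * Differentiation rules and monotonicity for real functions *)

Section RealDerivatives.
Variable R : realType.
Implicit Types (f g : R -> R) (x : R).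

Lemma is_derive_addf f g x df dg : is_derive x 1 f df -> is_derive x 1 g dg ->
  is_derive x 1 (fun t => f t + g t) (df + dg).
Proof. by move=> hf hg; exact: is_deriveD. Qed.

Lemma is_derive_subf f g x df dg : is_derive x 1 f df -> is_derive x 1 g dg ->
  is_derive x 1 (fun t => f t - g t) (df - dg).
Proof. by move=> hf hg; exact: is_deriveB. Qed.

Lemma is_derive_mulf f g x df dg : is_derive x 1 f df -> is_derive x 1 g dg ->
  is_derive x 1 (fun t => f t * g t) (df * g x + f x * dg).
Proof.
move=> hf hg; have -> : df * g x + f x * dg = f x *: dg + g x *: df.
  by rewrite addrC /GRing.scale /= [g x * _]mulrC.
by have := is_deriveM hf hg; exact.
Qed.

Lemma is_derive_expf f x df : is_derive x 1 f df ->
  is_derive x 1 (fun t => expR (f t)) (expR (f x) * df).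
Proof. by move=> hf; exact: is_derive1_comp. Qed.

Lemma is_derive_linear (k x : R) : is_derive x 1 (fun t => k * t) k.
Proof.
have hk : is_derive x 1 (fun=> k) 0 by exact: is_derive_cst.
have hid : is_derive x 1 (fun t : R => t) 1 by exact: is_derive_id.
by have := is_derive_mulf hk hid; rewrite mul0r add0r mulr1.
Qed.

Lemma is_derive_le0_le f df (a b : R) : a <= b ->
  (forall x, a <= x -> is_derive x 1 f (df x)) ->
  (forall x, a <= x -> df x <= 0) -> f b <= f a.
Proof.
move=> ab hf hd.
have ax x : x \in `]a, b[ -> a <= x by rewrite in_itv/= => /andP[/ltW].
apply: (@ler0_derive1_le_cc _ f a b); rewrite ?in_itv/= ?lexx ?ab//.
- by move=> x /ax /hf [].
- by move=> x /ax ax'; rewrite derive1E; have [_ ->] := hf x ax'; exact: hd.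
- apply: derivable_within_continuous => x; rewrite in_itv/= => /andP[/hf []//].
Qed.

End RealDerivatives.

(** * Gronwall estimates and linear differential systems *)

Section Gronwall.
Variable R : realType.
Implicit Types (f g : R -> R[i]) (l : R[i]).

(** The squared modulus as a real number; unlike the modulus, it is differentiable at 0 too. *)
Definition sqnorm (z : R[i]) : R := complex.Re z ^+ 2 + complex.Im z ^+ 2.

Lemma sqnorm_ge0 z : 0 <= sqnorm z.
Proof. by rewrite addr_ge0 ?sqr_ge0. Qed.

(** The derivative of |f|^2 is 2 Re(conj(f) f'); in the contribution of l f the imaginary part of
    [l] cancels. *)
Lemma is_derive_sqnorm f l (s : R) (w : R[i]) : cderive f s (l * f s + w) ->
  is_derive s 1 (fun t => sqnorm (f t))
    (2 * (complex.Re l * sqnorm (f s)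
      + (complex.Re (f s) * complex.Re w + complex.Im (f s) * complex.Im w))).
Proof.
move=> h.
have hR := h 1; have hI := h (0 -i* 1).
rewrite mul1r in hR; rewrite -im_re in hI.
have eR : (fun t => complex.Re (1 * f t)) = (fun t => complex.Re (f t)).
  by apply/funext => t; rewrite mul1r.
have eI : (fun t => complex.Re ((0 -i* 1) * f t)) = (fun t => complex.Im (f t)).
  by apply/funext => t; rewrite -im_re.
rewrite {}eR in hR; rewrite {}eI in hI.
have := is_derive_addf (is_derive_mulf hR hR) (is_derive_mulf hI hI).
set D := (X in is_derive _ _ _ X -> _); set D' := (X in _ -> is_derive _ _ _ X).
suff -> : D = D' by under eq_fun do rewrite -!expr2.
rewrite /D /D' /sqnorm; case: l (f s) w {h hR hI D D'} => [a b] [p q] [c d] /=.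
ring.
Qed.

(* With [e = d - Re l], AM-GM gives
   [(|f|^2)' <= (Re l + d) |f|^2 + |w|^2 / e]. *)
Lemma sqnorm_growth f g l (d C : R) : complex.Re l < d ->
  (forall s, 0 <= s -> cderive f s (l * f s + g s)) ->
  (forall s, 0 <= s -> sqnorm (g s) <= C * expR (2 * d * s)) ->
  exists C', forall s, 0 <= s -> sqnorm (f s) <= C' * expR (2 * d * s).
Proof.
move=> ld hf hg.
pose e := d - complex.Re l; pose m := complex.Re l + d.
have e0 : 0 < e by rewrite subr_gt0.
have C0 : 0 <= C.
  by have := hg 0 (lexx _); rewrite mulr0 expR0 mulr1; apply: le_trans (sqnorm_ge0 _).
(* With this value K e exp(2ds) = (C/e) exp(2ds), which dominates |g|^2 / e. *)
pose K := C / e ^+ 2.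
have K0 : 0 <= K by rewrite divr_ge0 ?sqr_ge0.
exists (sqnorm (f 0) + K) => s s0.
(* The integrating factor exp(-mt) removes the term m |f|^2; as 2d - m = e, the subtracted
   exponential makes [h] nonincreasing. *)
pose h t := expR (- m * t) * sqnorm (f t) - K * expR (e * t).
have : h s <= h 0.
  apply: (@is_derive_le0_le _ h (fun t => expR (- m * t) * - m * sqnorm (f t) +
    expR (- m * t) * (2 * (complex.Re l * sqnorm (f t)
      + (complex.Re (f t) * complex.Re (g t) + complex.Im (f t) * complex.Im (g t))))
    - (0 * expR (e * t) + K * (expR (e * t) * e)))) => // t t0.
    apply: is_derive_subf.
      apply: is_derive_mulf; last exact: is_derive_sqnorm (hf t t0).
      exact: (is_derive_expf (is_derive_linear (- m) t)).
    apply: is_derive_mulf; exact: (is_derive_expf (is_derive_linear e t)).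
  have -> : expR (e * t) = expR (- m * t) * expR (2 * d * t).
    by rewrite -expRD; congr expR; rewrite /e /m; ring.
  rewrite mul0r add0r.
  have := hg t t0; set E := expR (2 * d * t) => hgt.
  have -> : expR (- m * t) * - m * sqnorm (f t) +
    expR (- m * t) * (2 * (complex.Re l * sqnorm (f t)
      + (complex.Re (f t) * complex.Re (g t) + complex.Im (f t) * complex.Im (g t))))
    - K * (expR (- m * t) * E * e) =
    expR (- m * t) * (2 * (complex.Re (f t) * complex.Re (g t)
      + complex.Im (f t) * complex.Im (g t)) - e * sqnorm (f t) - K * e * E).
    by rewrite /e /m; ring.
  rewrite pmulr_rle0 ?expR_gt0//.
  have -> : K * e * E = C * E / e by rewrite /K; field; rewrite gt_eqF.
  rewrite subr_le0; apply: le_trans (_ : sqnorm (g t) / e <= _); last first.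
    by rewrite ler_pM2r ?invr_gt0.
  rewrite ler_pdivlMr// /sqnorm.
  case: (f t) (g t) => [p q] [a b] /=.
  (* After multiplication by [e], the AM-GM bound is the sum of these two squares being
     nonnegative. *)
  have := sqr_ge0 (e * p - a); have := sqr_ge0 (e * q - b).
  nra.
rewrite /h !mulr0 expR0 mul1r mulr1 => hs.
have -> : expR (2 * d * s) = expR (m * s) * expR (e * s).
  by rewrite -expRD; congr expR; rewrite /e /m; ring.
have h1 : expR (- m * s) * sqnorm (f s) <= (sqnorm (f 0) + K) * expR (e * s).
  have E1 : 1 <= expR (e * s) by rewrite -expR0 ler_expR mulr_ge0// ltW.
  have := sqnorm_ge0 (f 0); nra.
rewrite mulNr expRN mulrC ler_pdivrMr ?expR_gt0// in h1.
by rewrite [expR (m * s) * _]mulrC mulrA.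
Qed.

(** The function exp(-2 Re(l) t) |f(t)|^2 has zero derivative, hence keeps its value 0 at t = 0. *)
Lemma sqnorm_zero f l : (forall s, cderive f s (l * f s)) -> f 0 = 0 ->
  forall s, f s = 0.
Proof.
move=> hf f0 s; pose a := 2 * complex.Re l.
have hN (t : R) : is_derive t 1 (fun t => sqnorm (f t)) (a * sqnorm (f t)).
  have h : cderive f t (l * f t + 0) by rewrite addr0; exact: hf.
  have := is_derive_sqnorm h; set D := (X in is_derive _ _ _ X -> _).
  suff -> : D = a * sqnorm (f t) by [].
  by rewrite /D /= !mulr0 !addr0 mulrA.
pose h t := expR (- a * t) * sqnorm (f t).
have hh (t : R) : is_derive t 1 h 0.
  have := is_derive_mulf (is_derive_expf (is_derive_linear (- a) t)) (hN t).
  set D := (X in is_derive _ _ _ X -> _); suff -> : D = 0 by [].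
  by rewrite /D; ring.
have hE : h s = h 0 by apply: is_derive_0_is_cst.
have : sqnorm (f s) = 0.
  move: hE; rewrite /h f0 {2}/sqnorm /= expr0n /= addr0 mulr0 => /eqP.
  by rewrite mulf_eq0 gt_eqF ?expR_gt0//= => /eqP.
move/eqP; rewrite paddr_eq0 ?sqr_ge0// !sqrf_eq0 => /andP[/eqP hr /eqP hi].
by apply/eqP; rewrite eq_complex hr hi !eqxx.
Qed.

Variable n : nat.
Implicit Types (A B : 'M[R[i]]_n.+1) (Y Z : R -> 'M[R[i]]_n.+1).

Lemma mderive_mull B Y s D : mderive Y s D ->
  mderive (fun t => B *m Y t) s (B *m D).
Proof.
move=> h i j c.
have -> : (fun t => complex.Re (c * (B *m Y t) i j)) =
    (fun t => \sum_k complex.Re ((c * B i k) * Y t k j)).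
  apply/funext => t; rewrite mxE mulr_sumr re_sum.
  by apply: eq_bigr => k _; rewrite mulrA.
rewrite mxE mulr_sumr re_sum.
have -> : \sum_k complex.Re (c * (B i k * D k j)) =
    \sum_k complex.Re ((c * B i k) * D k j).
  by apply: eq_bigr => k _; rewrite mulrA.
have := @is_derive_sum _ _ _ _
  (fun k t => complex.Re ((c * B i k) * Y t k j)) s 1 _ (fun k => h k j (c * B i k)).
by under [X in is_derive _ _ X]funext do rewrite fct_sumE.
Qed.

Lemma mderive_sub Y Z s D E : mderive Y s D -> mderive Z s E ->
  mderive (fun t => Y t - Z t) s (D - E).
Proof.
move=> hY hZ i j c.
have -> : (fun t => complex.Re (c * (Y t - Z t) i j)) =
    (fun t => complex.Re (c * Y t i j) - complex.Re (c * Z t i j)).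
  by apply/funext => t; rewrite !mxE mulrBr reB.
by rewrite !mxE mulrBr reB; apply: is_derive_subf; [exact: hY | exact: hZ].
Qed.

Lemma mderive_scale (g : R -> R) Y (s : R) dg D : is_derive s 1 g dg -> mderive Y s D ->
  mderive (fun t => (g t)%:C *: Y t) s (dg%:C *: Y s + (g s)%:C *: D).
Proof.
move=> hg hY i j c.
have E (x : R) (z : R[i]) : complex.Re (c * (x%:C * z)) = x * complex.Re (c * z).
  by rewrite mulrCA mulrC reMr mulrC.
have -> : (fun t => complex.Re (c * ((g t)%:C *: Y t) i j)) =
    (fun t => g t * complex.Re (c * Y t i j)).
  by apply/funext => t; rewrite mxE E.
by rewrite !mxE mulrDr reD !E; apply: is_derive_mulf; exact: hY.
Qed.

Lemma mderive_comp (g : R -> R) Y (s : R) dg D : is_derive s 1 g dg ->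
  mderive Y (g s) D -> mderive (fun t => Y (g t)) s (dg%:C *: D).
Proof.
move=> hg hY i j c.
have -> : complex.Re (c * (dg%:C *: D) i j) = complex.Re (c * D i j) * dg.
  by rewrite mxE mulrCA mulrC reMr.
exact: is_derive1_comp (hY i j c) hg.
Qed.

(* [(B Y)' = B A Y = l (B Y) + (B (A - l)) Y]; the factors of a polynomial
   that annihilates [A] are thus removed one at a time. *)
Lemma mderive_factor A B Y (l : R[i]) s : mderive Y s (A *m Y s) ->
  forall i j, cderive (fun t => (B *m Y t) i j) s
    (l * (B *m Y s) i j + ((B *m (A - l%:M)) *m Y s) i j).
Proof.
move=> h i j; have -> : l * (B *m Y s) i j + ((B *m (A - l%:M)) *m Y s) i j =
    (B *m (A *m Y s)) i j.
  rewrite mulmxBr mulmxBl mul_mx_scalar -scalemxAl mulmxA.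
  by move: (B *m A *m Y s) (B *m Y s) => P X; rewrite !mxE addrCA subrr addr0.
exact: mderive_mull.
Qed.

(** The characteristic polynomial is monic and splits over the algebraically closed field [R[i]];
    Cayley-Hamilton evaluates its factorisation at [A]. The list also records that the spectrum is
    finite. *)
Lemma char_poly_roots A : exists2 rs : seq R[i],
  forall l, (l \in rs) = eigenvalue A l & \prod_(l <- rs) (A - l%:M) = 0.
Proof.
have [rs hrs] := closed_field_poly_normal (char_poly A).
rewrite (monicP (char_poly_monic A)) scale1r in hrs.
exists rs => [l|].
  by rewrite eigenvalue_root_char hrs root_prod_XsubC.
have := Cayley_Hamilton A; rewrite hrs rmorph_prod /= => <-.
by apply: eq_bigr => l _; rewrite rmorphB /= horner_mx_X horner_mx_C.
Qed.

Lemma ode_growth A Y (d : R) : (forall l, eigenvalue A l -> complex.Re l < d) ->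
  (forall s, mderive Y s (A *m Y s)) ->
  forall i j, exists C, forall s, 0 <= s -> sqnorm (Y s i j) <= C * expR (2 * d * s).
Proof.
move=> hd hY.
have [rs hrs' h0] := char_poly_roots A.
have hrs l : l \in rs -> eigenvalue A l by rewrite hrs'.
(* The claim is generalised to B Y, where [B] kills the product of the remaining factors: B = I is
   the claim itself, and an empty list forces B = 0. *)
suff : forall B, B *m \prod_(l <- rs) (A - l%:M) = 0 -> forall i j,
    exists C, forall s, 0 <= s -> sqnorm ((B *m Y s) i j) <= C * expR (2 * d * s).
  move=> /(_ 1%:M); rewrite mul1mx => /(_ h0) h i j.
  by have [C hC] := h i j; exists C => s /hC; rewrite mul1mx.
elim: rs hrs {h0 hrs'} => [|l rs IH] hrs B.
  rewrite big_nil mulmx1 => -> i j; exists 0 => s _.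
  by rewrite mul0mx mxE /sqnorm /= expr0n /= addr0 mul0r.
rewrite big_cons mulmxA => hB i j.
have [|C hC] := IH _ (B *m (A - l%:M)) hB i j.
  by move=> k krs; apply: hrs; rewrite inE krs orbT.
apply: (sqnorm_growth (l := l) _ _ hC); first by apply/hd/hrs; rewrite inE eqxx.
by move=> s _; apply: mderive_factor.
Qed.

(** The same descent: once B (A - l) Y vanishes, each entry of B Y solves z' = l z with z(0) = 0. *)
Lemma ode_unique A Y : (forall s, mderive Y s (A *m Y s)) -> Y 0 = 0 ->
  forall s, Y s = 0.
Proof.
move=> hY Y0 s.
have [rs _ h0] := char_poly_roots A.
suff : forall B, B *m \prod_(l <- rs) (A - l%:M) = 0 -> forall s, B *m Y s = 0.
  by move=> /(_ 1%:M); rewrite mul1mx => /(_ h0 s); rewrite mul1mx.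
elim: rs {h0 s} => [|l rs IH] B.
  by rewrite big_nil mulmx1 => -> s; rewrite mul0mx.
rewrite big_cons mulmxA => /IH hB s; apply/matrixP => i j; rewrite [RHS]mxE.
apply: (@sqnorm_zero (fun t => (B *m Y t) i j) l) => [t|]; last first.
  by rewrite Y0 mulmx0 mxE.
by have := mderive_factor B l (hY t) i j; rewrite hB [X in _ + X]mxE addr0.
Qed.

End Gronwall.

(** * Improper integrals over subsets of the positive half-line *)

Section ImproperIntegral.
Variable R : realType.
Implicit Types (f g F G : R -> R).
Local Notation mu := lebesgue_measure.

Lemma continuous_pos_within f (A : set R) : (forall u, A u -> 0 < u) ->
  (forall u : R, 0 < u -> {for u, continuous f}) -> {within A, continuous f}.
Proof.
by move=> hA hf; apply: continuous_in_subspaceT => u; rewrite inE => /hA; exact: hf.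
Qed.

Lemma measurable_fun_pos f (A : set R) : measurable A -> (forall u, A u -> 0 < u) ->
  (forall u : R, 0 < u -> {for u, continuous f}) -> measurable_fun A f.
Proof.
move=> mA hA hf; apply: subspace_continuous_measurable_fun => //.
exact: continuous_pos_within.
Qed.

Lemma FTC_pos F f (a b : R) : 0 < a -> a < b ->
  (forall u : R, 0 < u -> is_derive u 1 F (f u)) ->
  (forall u : R, 0 < u -> {for u, continuous f}) ->
  (\int[mu]_(u in `[a, b]) (f u)%:E = (F b - F a)%:E)%E.
Proof.
move=> a0 ab hF cf.
have cF (u : R) : 0 < u -> {for u, continuous F}.
  by move=> /hF[dF _]; apply: differentiable_continuous; exact/derivable1_diffP.
rewrite EFinB; apply: continuous_FTC2 => //.
- apply: continuous_pos_within => // u; rewrite /= in_itv/= => /andP[+ _].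
  exact: lt_le_trans.
- split.
  + by move=> u; rewrite in_itv/= => /andP[au _]; have [] := hF u (lt_trans a0 au).
  + exact/cvg_at_right_filter/cF.
  + exact/cvg_at_left_filter/cF/(lt_trans a0).
- move=> u; rewrite in_itv/= => /andP[au _].
  by rewrite derive1E; have [_ ->] := hF u (lt_trans a0 au).
Qed.

(** * Exhaustion by increasing compact intervals *)

Section Exhaustion.
Variables a b : R^nat.
Hypothesis a_gt0 : forall n, 0 < a n.
Hypothesis lt_ab : forall n, a n < b n.
Hypothesis a_noninc : nonincreasing_seq a.
Hypothesis b_nondec : nondecreasing_seq b.

Let I n : set R := `[a n, b n]%classic.
Let D := \bigcup_n I n.

Let mI n : measurable (I n). Proof. exact: measurable_itv. Qed.

Let mD : measurable D. Proof. exact: bigcup_measurable. Qed.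

Let I_gt0 n u : I n u -> 0 < u.
Proof. by rewrite /I /= in_itv/= => /andP[+ _]; exact: lt_le_trans. Qed.

Let D_gt0 u : D u -> 0 < u. Proof. by move=> [n _]; exact: I_gt0. Qed.

Let ndI : nondecreasing_seq I.
Proof.
move=> m n mn; rewrite subsetEset => u; rewrite /I /= !in_itv/= => /andP[h1 h2].
by rewrite (le_trans (a_noninc mn) h1) (le_trans h2 (b_nondec mn)).
Qed.

(** By monotone convergence the integral of [g] over [D] is the limit of the increments G(b_n) -
    G(a_n), hence at most [M]; integrability passes from [g] to [f] by domination. *)
Lemma integrable_dominated_pos f g G (M : R) :
  (forall u : R, 0 < u -> {for u, continuous f}) ->
  (forall u : R, 0 < u -> {for u, continuous g}) ->
  (forall u : R, 0 < u -> is_derive u 1 G (g u)) ->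
  (forall u, D u -> `|f u| <= g u) ->
  (forall n, G (b n) - G (a n) <= M) ->
  mu.-integrable D (EFin \o f).
Proof.
move=> cf cg hG fg hM.
have mf : measurable_fun D f by exact: measurable_fun_pos.
have mg : measurable_fun D g by exact: measurable_fun_pos.
have g0 u : D u -> (0 <= (g u)%:E)%E.
  by move=> /fg; rewrite lee_fin; exact: le_trans.
apply: (@le_integrable _ _ _ mu _ mD (EFin \o f) (EFin \o g)).
- exact/measurable_EFinP.
- by move=> u /fg; rewrite /= lee_fin => /le_trans; apply; exact: ler_norm.
apply/integrableP; split; first exact/measurable_EFinP.
have -> : (\int[mu]_(u in D) `|(EFin \o g) u| = \int[mu]_(u in D) (g u)%:E)%E.
  by apply: eq_integral => u; rewrite inE => /g0 gu; rewrite /= ger0_norm.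
have h : (\int[mu]_(u in I n) (g u)%:E @[n --> \oo] -->
    \int[mu]_(u in D) (g u)%:E)%E.
  apply: ge0_nondecreasing_set_cvg_integral => //.
  - by move=> n; apply/measurable_EFinP; apply: measurable_funS mg => // u; exists n.
  - by move=> n u Iu; apply: g0; exists n.
apply: (@le_lt_trans _ _ M%:E); last exact: ltry.
rewrite -(cvg_lim _ h)//; apply: lime_le; first by apply: cvgP; exact: h.
by near=> n; rewrite (FTC_pos (F := G))// lee_fin.
Unshelve. all: by end_near. Qed.

Lemma Rintegral_FTC_exhaustion F f (l : R) :
  (forall u : R, 0 < u -> {for u, continuous f}) ->
  (forall u : R, 0 < u -> is_derive u 1 F (f u)) ->
  mu.-integrable D (EFin \o f) ->
  F (b n) - F (a n) @[n --> \oo] --> l ->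
  (\int[mu]_(u in D) f u)%R = l.
Proof.
move=> cf hF If hl.
have mf : measurable_fun D (EFin \o f).
  by apply/measurable_EFinP; exact: measurable_fun_pos.
have mfI n : measurable_fun (I n) (EFin \o f).
  by apply: measurable_funS mf => // u; exists n.
have h : (\int[mu]_(u in I n) (f u)%:E @[n --> \oo] -->
    \int[mu]_(u in D) (f u)%:E)%E.
  (* Monotone convergence is applied to the positive and negative parts separately; integrability of
     [f] keeps the difference of the limits from being indeterminate. *)
  rewrite integralE; under eq_cvg do rewrite integralE.
  apply: cvgeB.
  - by apply: fin_num_adde_defr; exact: integrable_pos_fin_num.
  - apply: ge0_nondecreasing_set_cvg_integral => //.
    by move=> n; apply: measurable_funepos; exact: mfI.
  - apply: ge0_nondecreasing_set_cvg_integral => //.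
    by move=> n; apply: measurable_funeneg; exact: mfI.
rewrite /Rintegral -(cvg_lim _ h)//.
have -> : (fun n => \int[mu]_(u in I n) (f u)%:E)%E =
    (fun n => (F (b n) - F (a n))%:E).
  by apply/funext => n; rewrite (FTC_pos (F := F)).
have -> // := @cvg_lim (\bar R) _ _ _ _ (fun n => (F (b n) - F (a n))%:E) l%:E.
by apply: cvg_EFin => //; near=> n.
Unshelve. all: by end_near. Qed.

End Exhaustion.
End ImproperIntegral.

(** * Functions dominated by exp(-u) (u^p + u^q) *)

Section PowerDomination.
Variable R : realType.
Local Notation mu := lebesgue_measure.

Lemma is_derive_continuous (f : R -> R) (u d : R) :
  is_derive u 1 f d -> {for u, continuous f}.
Proof. by move=> [df _]; apply: differentiable_continuous; exact/derivable1_diffP. Qed.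

Lemma is_derive_powR_primitive (p : R) (u : R) : -1 < p -> 0 < u ->
  is_derive u 1 (fun t => (p + 1)^-1 * t `^ (p + 1)) (u `^ p).
Proof.
move=> p1 u0; have p0 : p + 1 != 0 by rewrite gt_eqF// -ltrBlDr sub0r.
have hc : is_derive u 1 (fun _ : R => (p + 1)^-1) 0 by exact: is_derive_cst.
have := is_derive_mulf hc (is_derive1_powR (p + 1) u0).
by rewrite mul0r add0r mulrA mulVf// mul1r addrK.
Qed.

(** Half of the exponential decay absorbs the power: in logarithms, p ln u - u/2 is bounded above on
    [x, oo). *)
Lemma powR_expR_le (x p : R) : 0 < x -> exists2 C, 0 <= C & forall u, x <= u ->
  expR (- u) * u `^ p <= C * expR (- 2^-1 * u).
Proof.
move=> x0.
suff [c hc] : exists c, forall u, x <= u -> p * ln u <= c + 2^-1 * u.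
  exists (expR c) => [|u xu]; first exact: expR_ge0.
  rewrite /powR gt_eqF ?(lt_le_trans x0)// -!expRD ler_expR.
  by have := hc u xu; lra.
have [p0|p0] := ltP 0 p.
  (* From ln v < v at v = u/(2p), multiplied by [p]. *)
  exists (p * ln (2 * p)) => u xu; have u0 : 0 < u := lt_le_trans x0 xu.
  have v0 : 0 < u / (2 * p) by rewrite divr_gt0// mulr_gt0.
  have uE : u = 2 * p * (u / (2 * p)) by field; rewrite gt_eqF.
  have -> : ln u = ln (2 * p) + ln (u / (2 * p)).
    by rewrite {1}uE lnM ?posrE// mulr_gt0.
  have -> : 2^-1 * u = p * (u / (2 * p)) by field; rewrite gt_eqF.
  by rewrite mulrDr lerD2l ler_pM2l// ltW// ln_sublinear.
(* For p <= 0 the function p ln u is largest at the left end u = x. *)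
exists (p * ln x) => u xu; have u0 : 0 < u := lt_le_trans x0 xu.
apply: (@le_trans _ _ (p * ln x)); first by rewrite ler_wnM2l// ler_ln.
by rewrite lerDl mulr_ge0// ltW.
Qed.

Lemma cvg_expR_arith (k d : R) : 0 < d ->
  expR (k - d * n.+1%:R) @[n --> \oo] --> 0.
Proof.
move=> d0; have -> : (fun n : nat => expR (k - d * n.+1%:R)) =
    (fun n : nat => expR k * expR (- d) ^+ n.+1).
  apply/funext => n; rewrite expRD; congr (_ * _).
  by rewrite -expRM_natr mulNr.
rewrite -[X in _ --> X](mulr0 (expR k)); apply: cvgMr.
rewrite (cvg_shiftS (fun n => expR (- d) ^+ n)); apply: cvg_expr.
by rewrite ger0_norm ?expR_ge0// -expR0 ltr_expR oppr_lt0.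
Qed.

Variable x : R.
Hypothesis x0 : 0 < x.

(** This is x exp(-(n+1)): its powers are again geometric sequences, and the shift by one keeps it
    strictly below [x] from n = 0 on. *)
Definition lower_seq (n : nat) : R := expR (ln x - n.+1%:R).

Lemma lower_seq_gt0 n : 0 < lower_seq n. Proof. exact: expR_gt0. Qed.

Lemma lower_seq_lt n : lower_seq n < x.
Proof. by rewrite -[ltRHS]lnK ?posrE// ltr_expR ltrBlDr ltrDl. Qed.

Lemma lower_seq_noninc : nonincreasing_seq lower_seq.
Proof. by move=> m n mn; rewrite ler_expR lerD2l lerN2 ler_nat. Qed.

Lemma lower_bigcup : (`]0, x] = \bigcup_n `[lower_seq n, x])%classic.
Proof.
apply/seteqP; split => u /=; last first.
  move=> [n _]; rewrite /= !in_itv/= => /andP[h ->]; rewrite andbT.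
  exact: lt_le_trans (lower_seq_gt0 n) h.
rewrite in_itv/= => /andP[u0 ux].
have : \forall n \near \oo, lower_seq n < u.
  have := cvg_expR_arith (ln x) (ltr01 : (0 : R) < 1).
  move/cvgr_lt => /(_ u u0); apply: filterS => n.
  by rewrite mul1r.
by move=> [n _ /(_ n (leqnn n)) /= h]; exists n => //=; rewrite in_itv/= (ltW h).
Qed.

Definition upper_seq (n : nat) : R := x + n.+1%:R.

Lemma upper_seq_gt n : x < upper_seq n. Proof. by rewrite ltrDl. Qed.

Lemma upper_seq_nondec : nondecreasing_seq upper_seq.
Proof. by move=> m n mn; rewrite lerD2l ler_nat. Qed.

Lemma upper_bigcup : (`[x, +oo[ = \bigcup_n `[x, upper_seq n])%classic.
Proof.
apply/seteqP; split => u /=; last first.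
  by move=> [n _]; rewrite /= !in_itv/= andbT => /andP[].
rewrite in_itv/= andbT => xu; exists (Num.truncn u) => //=.
rewrite in_itv/= xu /= /upper_seq ltW// (lt_le_trans (truncnS_gt u))//.
by rewrite lerDr ltW.
Qed.

Lemma powR_lower_seq (p : R) : 0 < p -> lower_seq n `^ p @[n --> \oo] --> 0.
Proof.
move=> p0; have := cvg_expR_arith (p * ln x) p0.
suff -> : (fun n : nat => expR (p * ln x - p * n.+1%:R)) =
  (fun n => lower_seq n `^ p) by [].
apply/funext => n; by rewrite /powR gt_eqF ?lower_seq_gt0// /lower_seq expRK mulrBr.
Qed.

Lemma expR_upper_seq : expR (- 2^-1 * upper_seq n) @[n --> \oo] --> 0.
Proof.
have := @cvg_expR_arith (- 2^-1 * x) 2^-1 _.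
rewrite invr_gt0 ltr0n => /(_ isT).
suff -> : (fun n : nat => expR (- 2^-1 * x - 2^-1 * n.+1%:R)) =
  (fun n => expR (- 2^-1 * upper_seq n)) by [].
apply/funext => n; by rewrite /upper_seq mulrDr !mulNr.
Qed.

Variables (f : R -> R) (C p q : R).
Hypothesis fle : forall u : R, 0 < u -> `|f u| <= C * (expR (- u) * (u `^ p + u `^ q)).

Lemma dominating_constant_ge0 : 0 <= C.
Proof.
have := le_trans (normr_ge0 _) (fle x0).
by rewrite pmulr_lge0// mulr_gt0 ?expR_gt0// addr_gt0// powR_gt0.
Qed.

Lemma dominated_upper_seq : f (upper_seq n) @[n --> \oo] --> 0.
Proof.
have [Cp Cp0 hp] := powR_expR_le p x0; have [Cq Cq0 hq] := powR_expR_le q x0.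
have h : C * (Cp + Cq) * expR (- 2^-1 * upper_seq n) @[n --> \oo] --> 0.
  rewrite -[X in _ --> X](mulr0 (C * (Cp + Cq))).
  by apply: cvgMr; exact: expR_upper_seq.
apply/norm_cvg0P; apply: (squeeze_cvgr _ _ h); last exact: cvg_cst.
near=> n; rewrite normr_ge0 /=.
have xu := ltW (upper_seq_gt n).
apply: le_trans (fle (lt_le_trans x0 xu)) _.
rewrite -mulrA ler_wpM2l ?dominating_constant_ge0// mulrDr mulrDl lerD//.
  exact: hp.
exact: hq.
Unshelve. all: by end_near. Qed.

Lemma dominated_lower_seq : 0 < p -> 0 < q -> f (lower_seq n) @[n --> \oo] --> 0.
Proof.
move=> p0 q0.
have h : C * (lower_seq n `^ p + lower_seq n `^ q) @[n --> \oo] --> 0.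
  rewrite -[X in _ --> X](mulr0 C) -[X in C * X](addr0 0).
  by apply: cvgMr; apply: cvgD; exact: powR_lower_seq.
apply/norm_cvg0P; apply: (squeeze_cvgr _ _ h); last exact: cvg_cst.
near=> n; rewrite normr_ge0 /=.
apply: le_trans (fle (lower_seq_gt0 n)) _.
rewrite ler_wpM2l ?dominating_constant_ge0// ler_piMl ?addr_ge0 ?powR_ge0//.
by rewrite -expR0 ler_expR oppr_le0 ltW// lower_seq_gt0.
Unshelve. all: by end_near. Qed.

Hypothesis cf : forall u : R, 0 < u -> {for u, continuous f}.
Hypothesis p1 : -1 < p.
Hypothesis q1 : -1 < q.

(** Near 0 the factor exp(-u) <= 1 is dropped. As p, q > -1, the remaining powers have a primitive
    [G] that is nonnegative, so its increments up to [x] are at most G(x). *)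
Lemma dominated_integrable_lower : mu.-integrable `]0, x]%classic (EFin \o f).
Proof.
rewrite lower_bigcup.
pose G u := C * ((p + 1)^-1 * u `^ (p + 1) + (q + 1)^-1 * u `^ (q + 1)).
pose g u := C * (u `^ p + u `^ q).
have p1' : 0 < p + 1 by rewrite -ltrBlDr sub0r.
have q1' : 0 < q + 1 by rewrite -ltrBlDr sub0r.
have C0 := dominating_constant_ge0.
apply: (@integrable_dominated_pos _ lower_seq (fun=> x) _ _ _ _ f g G (G x)) => //.
- exact: lower_seq_gt0.
- exact: lower_seq_lt.
- exact: lower_seq_noninc.
- move=> u u0; apply: cvgMr; apply: cvgD;
    exact: (is_derive_continuous (is_derive1_powR _ u0)).
- move=> u u0.
  have hc : is_derive u 1 (fun _ : R => C) 0 by exact: is_derive_cst.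
  have := is_derive_mulf hc (is_derive_addf
    (is_derive_powR_primitive p1 u0) (is_derive_powR_primitive q1 u0)).
  by rewrite mul0r add0r.
- move=> u; rewrite -lower_bigcup /= in_itv/= => /andP[u0 _].
  apply: le_trans (fle u0) _.
  rewrite ler_wpM2l// ler_piMl ?addr_ge0 ?powR_ge0//.
  by rewrite -expR0 ler_expR oppr_le0 ltW.
- move=> n; rewrite gerBl mulr_ge0// addr_ge0// mulr_ge0 ?powR_ge0// invr_ge0 ltW//.
Qed.

(** Both powers are absorbed into K exp(-u/2), whose primitive [G] is nonpositive; its increments
    from [x] are at most -G(x). *)
Lemma dominated_integrable_upper : mu.-integrable `[x, +oo[%classic (EFin \o f).
Proof.
have [Cp Cp0 hp] := powR_expR_le p x0; have [Cq Cq0 hq] := powR_expR_le q x0.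
rewrite upper_bigcup.
pose K := C * (Cp + Cq).
pose G u := - 2 * K * expR (- 2^-1 * u).
pose g u := K * expR (- 2^-1 * u).
have C0 := dominating_constant_ge0.
have K0 : 0 <= K by rewrite mulr_ge0// addr_ge0.
have hE (u : R) :
    is_derive u 1 (fun t => expR (- 2^-1 * t)) (expR (- 2^-1 * u) * - 2^-1).
  exact: (is_derive_expf (is_derive_linear _ u)).
apply: (@integrable_dominated_pos _ (fun=> x) upper_seq _ _ _ _ f g G (- G x)) => //.
- exact: upper_seq_gt.
- exact: upper_seq_nondec.
- by move=> u u0; apply: cvgMr; exact: (is_derive_continuous (hE u)).
- move=> u u0.
  have hc : is_derive u 1 (fun _ : R => - 2 * K) 0 by exact: is_derive_cst.
  have := is_derive_mulf hc (hE u).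
  suff -> : 0 * expR (- 2^-1 * u) + - 2 * K * (expR (- 2^-1 * u) * - 2^-1) = g u by [].
  by rewrite /g; field.
- move=> u; rewrite -upper_bigcup /= in_itv/= andbT => xu.
  apply: le_trans (fle (lt_le_trans x0 xu)) _.
  rewrite /g -mulrA ler_wpM2l// mulrDr mulrDl lerD//.
    exact: hp.
  exact: hq.
- move=> n; rewrite addrC gerDl /G !mulNr oppr_le0. 
  by apply: mulr_ge0 (expR_ge0 _); apply: mulr_ge0.
Qed.

End PowerDomination.

(** * Matrix powers, spectral bounds and matrix integrals *)

Section MatrixPower.
Variable R : realType.
Variable n : nat.
Implicit Types (A Q : 'M[R[i]]_n.+1).
Local Notation mu := lebesgue_measure.

(** Both sides solve Y' = Q Y with Y(0) = I, since differentiating the scalar factor restores the I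
    subtracted from [Q]. *)
Lemma mxexp_shift Q (s : R) :
  mxexp (s%:C *: Q) = (expR s)%:C *: mxexp (s%:C *: (Q - 1%:M)).
Proof.
pose Y (t : R) := mxexp (t%:C *: Q) - (expR t)%:C *: mxexp (t%:C *: (Q - 1%:M)).
apply/eqP; rewrite -subr_eq0; apply/eqP.
apply: (@ode_unique _ _ Q Y) => [t|]; last first.
  by rewrite /Y !mxexp0 expR0 scale1r subrr.
have := mderive_sub (mxexp_derive Q t)
  (mderive_scale (is_derive_expR t) (mxexp_derive (Q - 1%:M) t)).
suff -> : Q *m mxexp (t%:C *: Q) - ((expR t)%:C *: mxexp (t%:C *: (Q - 1%:M))
   + (expR t)%:C *: ((Q - 1%:M) *m mxexp (t%:C *: (Q - 1%:M)))) = Q *m Y t by [].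
rewrite /Y mulmxBr -scalemxAr; congr (_ - _).
by rewrite -scalerDr mulmxBl mul1mx addrC subrK.
Qed.

Lemma mxpow_shift Q (u : R) : 0 < u -> mxpow u Q = u%:C *: mxpow u (Q - 1%:M).
Proof. by move=> u0; rewrite /mxpow mxexp_shift lnK ?posrE. Qed.

Lemma mxpow_derive A (u : R) : 0 < u ->
  mderive (fun t => mxpow t A) u (u^-1%:C *: (A *m mxpow u A)).
Proof.
by move=> u0; apply: mderive_comp (is_derive1_ln u0) (mxexp_derive A (ln u)).
Qed.

Lemma exp_mxpow_derive A (u : R) : 0 < u ->
  mderive (fun t => (expR (- t))%:C *: mxpow t A) u
    ((- expR (- u))%:C *: mxpow u A
     + (expR (- u))%:C *: (u^-1%:C *: (A *m mxpow u A))).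
Proof.
move=> u0; apply: mderive_scale (mxpow_derive A u0).
have hN : is_derive u 1 (fun t : R => - t) (- 1).
  by have := is_derive_linear (- 1) u; under eq_fun do rewrite mulN1r.
by have := is_derive_expf hN; rewrite mulrN1.
Qed.

(** The primitive W of the overview is itself the integrand for Q + I, so one function serves as
    integrand and as boundary term. *)
Lemma gamma_integrandE Q (u : R) : gamma_integrand (Q + 1%:M) u =
  (expR (- u))%:C *: mxpow u Q.
Proof. by rewrite /gamma_integrand addrK. Qed.

Lemma gamma_integrand_derive Q (u : R) : 0 < u ->
  mderive (gamma_integrand (Q + 1%:M)) u
    (Q *m gamma_integrand Q u - gamma_integrand (Q + 1%:M) u).
Proof.
move=> u0; have := exp_mxpow_derive Q u0.
under eq_fun do rewrite -gamma_integrandE.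
set D := (X in mderive _ _ X -> _).
suff -> : D = Q *m gamma_integrand Q u - gamma_integrand (Q + 1%:M) u by [].
rewrite /D gamma_integrandE addrC rmorphN scaleNr; congr (_ - _).
(* The factor 1/u from the derivative of ln u cancels against u^Q = u u^(Q-I). *)
rewrite (mxpow_shift Q u0) /gamma_integrand -!scalemxAr; congr (_ *: _).
by rewrite scalerA -rmorphM mulVf ?gt_eqF// scale1r.
Qed.

Lemma continuous_gamma_integrand A (c : R[i]) i j (u : R) : 0 < u ->
  {for u, continuous (fun t => complex.Re (c * gamma_integrand A t i j))}.
Proof.
by move=> u0; exact: is_derive_continuous (exp_mxpow_derive (A - 1%:M) u0 i j c).
Qed.

(** Finiteness of the spectrum yields a uniform gap; each eigenvalue lowers [d] at most to the
    midpoint between [a] and its real part. *)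
Lemma lower_spectral_bound A (a : R) : (forall l, eigenvalue A l -> a < complex.Re l) ->
  exists2 d, a < d & forall l, eigenvalue A l -> d < complex.Re l.
Proof.
move=> h; have [rs hrs _] := char_poly_roots A.
have {}h l : l \in rs -> a < complex.Re l by rewrite hrs; exact: h.
suff [d ad hd] : exists2 d, a < d & forall l, l \in rs -> d < complex.Re l.
  by exists d => // l; rewrite -hrs; exact: hd.
elim: rs h {hrs} => [|l rs IH] h; first by exists (a + 1) => //; rewrite ltrDl.
have [|d ad hd] := IH; first by move=> k krs; apply: h; rewrite inE krs orbT.
have al : a < complex.Re l by apply: h; rewrite inE eqxx.
exists (Num.min d ((a + complex.Re l) / 2)).
  by rewrite lt_min ad /=; lra.
move=> k; rewrite inE => /predU1P[->|/hd dk]; rewrite gt_min.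
  by apply/orP; right; lra.
by rewrite dk.
Qed.

Lemma eigenvalue_opp A l : eigenvalue (- A) l -> eigenvalue A (- l).
Proof.
move=> /eigenvalueP[v hv v0]; apply/eigenvalueP; exists v => //.
by rewrite scaleNr -hv mulmxN opprK.
Qed.

(** The difference of the two sides is the square of the imaginary part of z w. *)
Lemma re_sqr_le (z w : R[i]) : complex.Re (z * w) ^+ 2 <= sqnorm z * sqnorm w.
Proof.
case: z w => [a b] [c d]; rewrite /sqnorm /=.
by have := sqr_ge0 (a * d + b * c); nra.
Qed.

Lemma re_le_of_sqnorm (z w : R[i]) (C s d : R) : sqnorm w <= C * expR (2 * d * s) ->
  `|complex.Re (z * w)| <= Num.sqrt (sqnorm z * C) * expR (d * s).
Proof.
move=> h.
have C0 : 0 <= C.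
  by have := le_trans (sqnorm_ge0 w) h; rewrite pmulr_lge0// expR_gt0.
rewrite -ler_sqr ?nnegrE ?mulr_ge0 ?sqrtr_ge0 ?expR_ge0//.
rewrite real_normK ?num_real// exprMn sqr_sqrtr ?mulr_ge0 ?sqnorm_ge0//.
apply: le_trans (re_sqr_le z w) _.
have -> : expR (d * s) ^+ 2 = expR (2 * d * s).
  by rewrite -expRM_natr; congr expR; ring.
by rewrite -[leRHS]mulrA; apply: ler_wpM2l; rewrite ?sqnorm_ge0.
Qed.

Lemma mxpow_growth Q : (forall l, eigenvalue Q l -> 0 < complex.Re l) ->
  exists d K : R, [/\ 0 < d, 0 < K & forall (c : R[i]) i j, exists C, forall u, 0 < u ->
    `|complex.Re (c * mxpow u Q i j)| <= C * (u `^ d + u `^ K)].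
Proof.
move=> hQ.
have [d d0 hd] := lower_spectral_bound hQ.
have [rs hrs _] := char_poly_roots Q.
(* Any number above all the real parts would do; this one is explicit and positive. *)
pose K := 1 + \sum_(l <- rs) `|complex.Re l|.
have K0 : 0 < K by rewrite ltr_pwDl// sumr_ge0.
have hK l : eigenvalue Q l -> complex.Re l < K.
  rewrite -hrs => lrs; rewrite /K (big_rem l)//=.
  rewrite (le_lt_trans (ler_norm _))// addrCA ltrDl.
  by rewrite ltr_wpDr// sumr_ge0.
exists d, K; split => // c i j.
(* Growth is estimated for nonnegative times only. For u < 1 time is reversed: exp(-sQ) solves the
   system of -Q, whose eigenvalues have real part below -d, and s = -ln u turns exp(-ds) into
   u^d. *)
have hN (s : R) : mderive (fun t => mxexp ((- t)%:C *: Q)) s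
    ((- Q) *m mxexp ((- s)%:C *: Q)).
  have hN : is_derive s 1 (fun t : R => - t) (- 1).
    by have := is_derive_linear (- 1) s; under eq_fun do rewrite mulN1r.
  have := mderive_comp hN (mxexp_derive Q (- s)).
  by rewrite rmorphN rmorph1 scaleN1r -mulNmx.
have hdN l : eigenvalue (- Q) l -> complex.Re l < - d.
  by move=> /eigenvalue_opp /hd; case: l => a b /=; rewrite ltrNr.
have [C1 h1] := ode_growth hK (mxexp_derive Q) i j.
have [C2 h2] := ode_growth hdN hN i j.
pose M1 := Num.sqrt (sqnorm c * C1); pose M2 := Num.sqrt (sqnorm c * C2).
exists (M1 + M2) => u u0; rewrite /powR gt_eqF//.
have M10 : 0 <= M1 by exact: sqrtr_ge0.
have M20 : 0 <= M2 by exact: sqrtr_ge0.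
have := expR_ge0 (d * ln u); have := expR_ge0 (K * ln u).
have [lu|lu] := leP 0 (ln u).
  have := re_le_of_sqnorm c (h1 _ lu); rewrite -/M1 -/(mxpow u Q).
  by nra.
have lu' : 0 <= - ln u by rewrite oppr_ge0 ltW.
have := h2 _ lu'; rewrite opprK => /(re_le_of_sqnorm c).
by rewrite mulrNN -/M2 -/(mxpow u Q); nra.
Qed.

Lemma Rintegral_sum (I : Type) (r : seq I) (D : set R) (f : I -> R -> R) :
  measurable D -> (forall k, mu.-integrable D (EFin \o f k)) ->
  mu.-integrable D (EFin \o (fun u => \sum_(k <- r) f k u)) /\
  (\int[mu]_(u in D) (\sum_(k <- r) f k u))%R =
    \sum_(k <- r) (\int[mu]_(u in D) f k u)%R.
Proof.
move=> mD h; elim: r => [|k r [IH1 IH2]].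
  have -> : (fun u => \sum_(k <- [::]) f k u) = (fun=> 0).
    by apply/funext => u; rewrite big_nil.
  by split; [exact: integrable0 | rewrite Rintegral_cst// mul0r big_nil].
have -> : (fun u => \sum_(k <- k :: r) f k u) =
    (fun u => f k u + \sum_(k <- r) f k u).
  by apply/funext => u; rewrite big_cons.
split; last by rewrite RintegralD// big_cons IH2.
exact: (@integrableD _ _ _ mu _ mD _ _ (h k) IH1).
Qed.

(** The cases c = 1 and c = -i are the definition of the matrix integral; the rest is real
    linearity. *)
Lemma Re_mxintegral (D : set R) (F : R -> 'M[R[i]]_n.+1) (c : R[i]) i j :
  measurable D ->
  (forall c : R[i], mu.-integrable D (EFin \o (fun u => complex.Re (c * F u i j)))) ->
  complex.Re (c * mxintegral D F i j) = (\int[mu]_(u in D) complex.Re (c * F u i j))%R.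
Proof.
move=> mD h.
have -> : (fun u => complex.Re (c * F u i j)) = (fun u =>
    complex.Re c * complex.Re (1 * F u i j)
    - complex.Im c * complex.Re ((0 -i* 1) * F u i j)).
  by apply/funext => u; rewrite re_mulE.
have hZ (k : R) (d : R[i]) : mu.-integrable D
    (EFin \o (fun u => k * complex.Re (d * F u i j))).
  exact: (@integrableZl _ _ _ mu _ mD k _ (h d)).
rewrite RintegralB// !RintegralZl// mxE re_mulE; congr (_ * _ - _ * _).
  by rewrite mul1r /=; under [in RHS]eq_Rintegral do rewrite mul1r.
by rewrite -im_re /=; under [in RHS]eq_Rintegral do rewrite -im_re.
Qed.

Lemma Re_mul_mxintegral (D : set R) (F G : R -> 'M[R[i]]_n.+1) (B : 'M[R[i]]_n.+1)
    (c : R[i]) i j : measurable D ->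
  (forall (c : R[i]) i j,
    mu.-integrable D (EFin \o (fun u => complex.Re (c * F u i j)))) ->
  (forall (c : R[i]) i j,
    mu.-integrable D (EFin \o (fun u => complex.Re (c * G u i j)))) ->
  mu.-integrable D (EFin \o (fun u => complex.Re (c * (B *m F u - G u) i j))) /\
  complex.Re (c * (B *m mxintegral D F - mxintegral D G) i j) =
    (\int[mu]_(u in D) complex.Re (c * (B *m F u - G u) i j))%R.
Proof.
move=> mD hF hG.
have E (M N : 'M[R[i]]_n.+1) : complex.Re (c * (B *m M - N) i j) =
    \sum_k complex.Re ((c * B i k) * M k j) - complex.Re (c * N i j).
  rewrite !mxE mulrBr reB mulr_sumr re_sum; congr (_ - _).
  by apply: eq_bigr => k _; rewrite mulrA.
have [If Ef] := @Rintegral_sum _ (index_enum 'I_n.+1) D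
  (fun k u => complex.Re ((c * B i k) * F u k j)) mD (fun k => hF _ k j).
under eq_fun do rewrite E.
rewrite E; split.
  exact: (@integrableB _ _ _ mu _ mD _ _ If (hG c i j)).
rewrite RintegralB// Ef; congr (_ - _); last by rewrite Re_mxintegral.
by apply: eq_bigr => k _; rewrite Re_mxintegral.
Qed.

(** * The recurrence for the incomplete gamma matrix functions *)

Section Recurrence.
Variable Q : 'M[R[i]]_n.+1.
Hypothesis hQ : forall l, eigenvalue Q l -> 0 < complex.Re l.
Variable x : R.
Hypothesis x0 : 0 < x.

(** The second estimate is the first divided by [u]. Positive exponents make W vanish at 0; lowered
    by one they stay above -1, which suffices for integrability there. *)
Lemma gamma_integrand_bound : exists d K : R, [/\ 0 < d, 0 < K & forall (c : R[i]) i j,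
  exists C, forall u, 0 < u ->
  `|complex.Re (c * gamma_integrand (Q + 1%:M) u i j)| <=
    C * (expR (- u) * (u `^ d + u `^ K)) /\
  `|complex.Re (c * gamma_integrand Q u i j)| <=
    C * (expR (- u) * (u `^ (d - 1) + u `^ (K - 1)))].
Proof.
have [d [K [d0 K0 h]]] := mxpow_growth hQ; exists d, K; split => // c i j.
have [C hC] := h c i j; exists C => u u0.
have E (k : R) (M : 'M[R[i]]_n.+1) : complex.Re (c * (k%:C *: M) i j) =
    k * complex.Re (c * M i j).
  by rewrite mxE mulrCA mulrC reMr mulrC.
have h1 : `|complex.Re (c * gamma_integrand (Q + 1%:M) u i j)| <=
    C * (expR (- u) * (u `^ d + u `^ K)).
  rewrite gamma_integrandE E normrM ger0_norm ?expR_ge0// mulrCA.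
  by rewrite ler_wpM2l ?expR_ge0// hC.
split => //.
have gE : u%:C *: gamma_integrand Q u = gamma_integrand (Q + 1%:M) u.
  rewrite gamma_integrandE (mxpow_shift Q u0) /gamma_integrand.
  by rewrite scalerA mulrC -scalerA.
have P p : u `^ p = u * u `^ (p - 1).
  have := @powRD _ u 1 (p - 1); rewrite (gt_eqF u0) implybT => /(_ isT).
  by rewrite powRr1 ?(ltW u0)// addrC subrK.
move: h1; rewrite -gE E normrM (gtr0_norm u0) (P d) (P K) -mulrDr.
by rewrite [expR _ * (u * _)]mulrCA [C * (u * _)]mulrCA ler_pM2l.
Qed.

(** The left sides integrate W', and W tends to 0 at both 0 and oo. What remains is the boundary
    value at [x], an upper endpoint in the first case and a lower one in the second, whence the
    opposite signs. *)
Lemma gamma_recurrence_entry (c : R[i]) i j :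
  complex.Re (c * (Q *m lower_gamma Q x - lower_gamma (Q + 1%:M) x) i j) =
    complex.Re (c * gamma_integrand (Q + 1%:M) x i j) /\
  complex.Re (c * (Q *m upper_gamma Q x - upper_gamma (Q + 1%:M) x) i j) =
    - complex.Re (c * gamma_integrand (Q + 1%:M) x i j).
Proof.
have [d [K [d0 K0 h]]] := gamma_integrand_bound.
have d1 : -1 < d - 1 by rewrite ltrBrDr addNr.
have K1 : -1 < K - 1 by rewrite ltrBrDr addNr.
have d1' : -1 < d by apply: lt_trans d0.
have K1' : -1 < K by apply: lt_trans K0.
pose W u := complex.Re (c * gamma_integrand (Q + 1%:M) u i j).
pose w u := complex.Re
  (c * (Q *m gamma_integrand Q u - gamma_integrand (Q + 1%:M) u) i j).
have hW (u : R) : 0 < u -> is_derive u 1 W (w u).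
  by move=> u0; exact: gamma_integrand_derive.
have cw (u : R) : 0 < u -> {for u, continuous w}.
  (* The derivative of W is a combination of two gamma integrands, each differentiable in turn. *)
  move=> u0; apply: is_derive_continuous.
  exact: (mderive_sub (mderive_mull Q (exp_mxpow_derive (Q - 1%:M) u0))
    (gamma_integrand_derive Q u0)) i j c.
have [C hC] := h c i j.
have WC u : 0 < u -> `|W u| <= C * (expR (- u) * (u `^ d + u `^ K)).
  by move=> u0; have [] := hC u u0.
split; rewrite /lower_gamma /upper_gamma.
  have [||Iw ->] := @Re_mul_mxintegral `]0, x]%classic (gamma_integrand Q)
      (gamma_integrand (Q + 1%:M)) Q c i j (measurable_itv _).
  - move=> e k l; have [C' hC'] := h e k l.
    apply: (@dominated_integrable_lower _ _ x0 _ C' (d - 1) (K - 1)) => //.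
      by move=> u u0; have [] := hC' u u0.
    by move=> u; exact: continuous_gamma_integrand.
  - move=> e k l; have [C' hC'] := h e k l.
    apply: (@dominated_integrable_lower _ _ x0 _ C' d K) => //.
      by move=> u u0; have [] := hC' u u0.
    by move=> u; exact: continuous_gamma_integrand.
  move: Iw; rewrite lower_bigcup => Iw.
  apply: (@Rintegral_FTC_exhaustion _ (lower_seq x) (fun=> x) _ _ _ _ W w) => //.
  - exact: lower_seq_gt0.
  - exact: lower_seq_lt.
  - exact: lower_seq_noninc.
  rewrite -[X in _ --> X]subr0; apply: cvgB; first exact: cvg_cst.
  exact: (dominated_lower_seq x0 WC).
have [||Iw ->] := @Re_mul_mxintegral `[x, +oo[%classic (gamma_integrand Q)
    (gamma_integrand (Q + 1%:M)) Q c i j (measurable_itv _).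
- move=> e k l; have [C' hC'] := h e k l.
  apply: (@dominated_integrable_upper _ _ x0 _ C' (d - 1) (K - 1)) => //.
    by move=> u u0; have [] := hC' u u0.
  by move=> u; exact: continuous_gamma_integrand.
- move=> e k l; have [C' hC'] := h e k l.
  apply: (@dominated_integrable_upper _ _ x0 _ C' d K) => //.
    by move=> u u0; have [] := hC' u u0.
  by move=> u; exact: continuous_gamma_integrand.
move: Iw; rewrite (upper_bigcup x0) => Iw.
apply: (@Rintegral_FTC_exhaustion _ (fun=> x) (upper_seq x) _ _ _ _ W w) => //.
- exact: upper_seq_gt.
- exact: upper_seq_nondec.
rewrite -[X in _ --> X]sub0r; apply: cvgB; last exact: cvg_cst.
exact: (dominated_upper_seq x0 WC).
Qed.

End Recurrence.
End MatrixPower.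

Theorem theorem2p1 (R : realType) (N : nat) (Q : 'M[R[i]]_N)
    (hQ : forall a : R[i], eigenvalue Q a -> 0 < complex.Re a)
    (x : R) (hx : 0 < x) :
  lower_gamma (Q + 1%:M) x =
    Q *m lower_gamma Q x - (expR (- x))%:C *: mxpow x Q
  /\
  upper_gamma (Q + 1%:M) x =
    Q *m upper_gamma Q x + (expR (- x))%:C *: mxpow x Q.
Proof.
(* Matrices of size 0 have no entries to compare; the preceding results concern positive size. *)
case: N Q hQ => [|n] Q hQ; first by split; apply/matrixP => -[].
have hr := gamma_recurrence_entry hQ hx; rewrite -gamma_integrandE.
set g := gamma_integrand _ _ in hr *.
split.
  (* Each identity is rearranged to isolate the difference computed by [hr], then tested on every
     functional Re(c z) of every entry. *)
  apply/eqP; rewrite eq_sym subr_eq addrC -subr_eq; apply/eqP/matrixP => i j.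
  by apply: eq_complex_Re => c; rewrite (hr c i j).1.
apply/eqP; rewrite eq_sym addrC -subr_eq0 -addrA addr_eq0; apply/eqP/matrixP => i j.
apply: eq_complex_Re => c; rewrite [in RHS]mxE mulrN.
have -> (z : R[i]) : complex.Re (- z) = - complex.Re z by case: z.
by rewrite (hr c i j).2 opprK.
Qed.
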